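(* $\mathsf{BIM}$ proves the equivalence of: (i) $\mathbf{Contr(BW)}$: for every sequence $\gamma$ of rationals, if for every $\zeta\in[\omega]^\omega$ there is $n$ with $|\gamma(\zeta(n+1))-\gamma(\zeta(n))|>\frac1{2^n}$, then $\exists n[\gamma(n)<0\vee\gamma(n)>1]$; (ii) $\mathbf{SC}([0,1])$: for every sequence $\gamma$ of rationals in $[0,1]$ and every $\alpha$, if for every $\zeta\in[\omega]^\omega$ there is $n$ with $|\gamma(\zeta(n+1))-\gamma(\zeta(n))|>\frac1{2^n}$ or $\alpha(n)\ne0$, then $\exists n[\alpha(n)\ne0]$.
   Context: $\mathsf{BIM}$ is the two-sorted formal theory with intuitionistic logic of natural numbers and functions $\mathbb N\to\mathbb N$, with extensionality, primitive recursive constants (including a coding of rationals), closure of functions under composition, primitive recursion and unbounded search, and full induction. Sequences of rationals are functions whose values code rationals. $[\omega]^\omega$ is the set of strictly increasing $\zeta:\mathbb N\to\mathbb N$. *)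

(* Defs.v *)
From Stdlib Require Import List.
Import ListNotations.

(** Constants for the primitive recursive functions.  All of them are unary: a
    function of several arguments is a unary function on codes formed with the
    pairing symbol [J], e.g. [f(m,n,p)] is [f(J(J(m,n),p))]. *)
Inductive pr : Type :=
| PId
| PZero
| PSucc
| PK
| PL
| PComp (f g : pr)
| PPair (f g : pr)
| PRec (f g : pr).

(** Number variables and function variables live in two independent de Bruijn
    index spaces: a number quantifier binds number index 0 and leaves function
    indices alone, and conversely. *)
Inductive fn : Type :=
| FVar (i : nat)
| FConst (c : pr).

Inductive tm : Type :=
| TVar (i : nat)
| TZero
| TJ (t s : tm)
| TApp (f : fn) (t : tm).

Inductive form : Type :=
| Bot
| EqN (t s : tm)
| EqF (f g : fn)
| And (A B : form)
| Or (A B : form)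
| Imp (A B : form)
| AllN (A : form)
| ExN (A : form)
| AllF (A : form)
| ExF (A : form).

Definition Not (A : form) : form := Imp A Bot.
Definition Iff (A B : form) : form := And (Imp A B) (Imp B A).

Coercion FConst : pr >-> fn.

Declare Scope bim_scope.
Delimit Scope bim_scope with bim.
Notation "# i" := (TVar i) (at level 1, format "# i") : bim_scope.
Notation "$ i" := (FVar i) (at level 1, format "$ i") : bim_scope.
Notation "f ⋅ t" := (TApp f t) (at level 30, right associativity) : bim_scope.
Notation "t == s" := (EqN t s) (at level 70) : bim_scope.
Notation "A /\ B" := (And A B) : bim_scope.
Notation "A \/ B" := (Or A B) : bim_scope.
Notation "~ A" := (Not A) : bim_scope.
Notation "A =>> B" := (Imp A B) (at level 90, right associativity) : bim_scope.
Notation "A <=> B" := (Iff A B) (at level 95) : bim_scope.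
Local Open Scope bim_scope.

Definition TS (t : tm) : tm := PSucc ⋅ t.

Definition scons {X : Type} (x : X) (s : nat -> X) (i : nat) : X :=
  match i with 0 => x | S j => s j end.

Definition fsubst (tau : nat -> fn) (f : fn) : fn :=
  match f with FVar i => tau i | FConst c => FConst c end.

Fixpoint tsubst (sigma : nat -> tm) (tau : nat -> fn) (t : tm) : tm :=
  match t with
  | TVar i => sigma i
  | TZero => TZero
  | TJ t s => TJ (tsubst sigma tau t) (tsubst sigma tau s)
  | TApp f t => TApp (fsubst tau f) (tsubst sigma tau t)
  end.

Definition sN (i : nat) : tm := TVar (S i).
Definition sF (i : nat) : fn := FVar (S i).

Definition upN (sigma : nat -> tm) : nat -> tm :=
  scons (TVar 0) (fun i => tsubst sN FVar (sigma i)).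
Definition upF (tau : nat -> fn) : nat -> fn :=
  scons (FVar 0) (fun i => fsubst sF (tau i)).

Fixpoint subst (sigma : nat -> tm) (tau : nat -> fn) (A : form) : form :=
  match A with
  | Bot => Bot
  | EqN t s => EqN (tsubst sigma tau t) (tsubst sigma tau s)
  | EqF f g => EqF (fsubst tau f) (fsubst tau g)
  | And A B => And (subst sigma tau A) (subst sigma tau B)
  | Or A B => Or (subst sigma tau A) (subst sigma tau B)
  | Imp A B => Imp (subst sigma tau A) (subst sigma tau B)
  | AllN A => AllN (subst (upN sigma) tau A)
  | ExN A => ExN (subst (upN sigma) tau A)
  | AllF A => AllF (subst (fun i => tsubst TVar sF (sigma i)) (upF tau) A)
  | ExF A => ExF (subst (fun i => tsubst TVar sF (sigma i)) (upF tau) A)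
  end.

Definition shiftN (A : form) : form := subst sN FVar A.
Definition shiftF (A : form) : form := subst TVar sF A.
Definition instN (t : tm) (A : form) : form := subst (scons t TVar) FVar A.
Definition instF (f : fn) (A : form) : form := subst TVar (scons f FVar) A.

Inductive BIM_axiom : form -> Prop :=
| Ax_ext :
    BIM_axiom (AllF (AllF (EqF $1 $0 <=> AllN ($1 ⋅ #0 == $0 ⋅ #0))))
| Ax_id : BIM_axiom (AllN (PId ⋅ #0 == #0))
| Ax_zero : BIM_axiom (AllN (PZero ⋅ #0 == TZero))
| Ax_S_nonzero : BIM_axiom (AllN (~ TS #0 == TZero))
| Ax_S_inj : BIM_axiom (AllN (AllN (TS #1 == TS #0 =>> #1 == #0)))
| Ax_K : BIM_axiom (AllN (AllN (PK ⋅ TJ #1 #0 == #1)))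
| Ax_L : BIM_axiom (AllN (AllN (PL ⋅ TJ #1 #0 == #0)))
| Ax_J : BIM_axiom (AllN (TJ (PK ⋅ #0) (PL ⋅ #0) == #0))
| Ax_comp (f g : pr) :
    BIM_axiom (AllN (PComp f g ⋅ #0 == f ⋅ g ⋅ #0))
| Ax_pair (f g : pr) :
    BIM_axiom (AllN (PPair f g ⋅ #0 == TJ (f ⋅ #0) (g ⋅ #0)))
| Ax_rec0 (f g : pr) :
    BIM_axiom (AllN (PRec f g ⋅ TJ #0 TZero == f ⋅ #0))
| Ax_recS (f g : pr) :
    BIM_axiom (AllN (AllN (PRec f g ⋅ TJ #1 (TS #0)
                           == g ⋅ TJ (TJ #1 #0) (PRec f g ⋅ TJ #1 #0))))
(* composition, with a one-place and with a two-place (coded) outer function *)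
| Ax_closed_comp :
    BIM_axiom (AllF (AllF (ExF (AllN ($0 ⋅ #0 == $2 ⋅ $1 ⋅ #0)))))
| Ax_closed_comp2 :
    BIM_axiom (AllF (AllF (AllF (ExF (AllN
      ($0 ⋅ #0 == $3 ⋅ TJ ($2 ⋅ #0) ($1 ⋅ #0)))))))
| Ax_closed_rec :
    BIM_axiom (AllF (AllF (ExF (AllN (AllN
      ($0 ⋅ TJ #1 TZero == $2 ⋅ #1 /\
       $0 ⋅ TJ #1 (TS #0) == $1 ⋅ TJ (TJ #1 #0) ($0 ⋅ TJ #1 #0)))))))
| Ax_closed_search :
    BIM_axiom (AllF (AllN (ExN ($0 ⋅ TJ #1 #0 == TZero)) =>>
                     ExF (AllN ($1 ⋅ TJ #0 ($0 ⋅ #0) == TZero))))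
(* induction for every formula; its other free variables are parameters *)
| Ax_ind (A : form) :
    BIM_axiom (instN TZero A =>>
               AllN (A =>> subst (scons (TS #0) sN) FVar A) =>>
               AllN A).

Inductive prv : list form -> form -> Prop :=
| P_ax G A : BIM_axiom A -> prv G A
| P_hyp G A : In A G -> prv G A
| P_botE G A : prv G Bot -> prv G A
| P_andI G A B : prv G A -> prv G B -> prv G (A /\ B)
| P_andE1 G A B : prv G (A /\ B) -> prv G A
| P_andE2 G A B : prv G (A /\ B) -> prv G B
| P_orI1 G A B : prv G A -> prv G (A \/ B)
| P_orI2 G A B : prv G B -> prv G (A \/ B)
| P_orE G A B C :
    prv G (A \/ B) -> prv (A :: G) C -> prv (B :: G) C -> prv G C
| P_impI G A B : prv (A :: G) B -> prv G (A =>> B)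
| P_impE G A B : prv G (A =>> B) -> prv G A -> prv G B
| P_allNI G A : prv (map shiftN G) A -> prv G (AllN A)
| P_allNE G A t : prv G (AllN A) -> prv G (instN t A)
| P_exNI G A t : prv G (instN t A) -> prv G (ExN A)
| P_exNE G A C :
    prv G (ExN A) -> prv (A :: map shiftN G) (shiftN C) -> prv G C
| P_allFI G A : prv (map shiftF G) A -> prv G (AllF A)
| P_allFE G A f : prv G (AllF A) -> prv G (instF f A)
| P_exFI G A f : prv G (instF f A) -> prv G (ExF A)
| P_exFE G A C :
    prv G (ExF A) -> prv (A :: map shiftF G) (shiftF C) -> prv G C
| P_eqN_refl G t : prv G (t == t)
| P_eqN_subst G A t s :
    prv G (t == s) -> prv G (instN t A) -> prv G (instN s A)
| P_eqF_refl G f : prv G (EqF f f)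
| P_eqF_subst G A f g :
    prv G (EqF f g) -> prv G (instF f A) -> prv G (instF g A).

Definition BIM_proves (A : form) : Prop := prv [] A.

(** [add(m,0) = m], [add(m,n+1) = S(add(m,n))] *)
Definition PAdd : pr := PRec PId (PComp PSucc PL).
(** [mul(m,0) = 0], [mul(m,n+1) = mul(m,n) + m] *)
Definition PMul : pr := PRec PZero (PComp PAdd (PPair PL (PComp PK PK))).
(** [exp(m,0) = 1], [exp(m,n+1) = exp(m,n) * m] *)
Definition PExp : pr :=
  PRec (PComp PSucc PZero) (PComp PMul (PPair PL (PComp PK PK))).
(** [pred(0) = 0], [pred(n+1) = n] *)
Definition PPred : pr :=
  PComp (PRec PZero (PComp PL PK)) (PPair PZero PId).
(** truncated subtraction: [sub(m,0) = m], [sub(m,n+1) = pred(sub(m,n))] *)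
Definition PSub : pr := PRec PId (PComp PPred PL).

Definition tadd (t s : tm) : tm := PAdd ⋅ TJ t s.
Definition tmul (t s : tm) : tm := PMul ⋅ TJ t s.
Definition texp (t s : tm) : tm := PExp ⋅ TJ t s.
Definition tsub (t s : tm) : tm := PSub ⋅ TJ t s.
Definition tone : tm := TS TZero.
Definition ttwo : tm := TS tone.

Definition le (t s : tm) : form :=
  ExN (tadd (tsubst sN FVar t) #0 == tsubst sN FVar s).
Definition lt (t s : tm) : form := le (TS t) s.

(** The number [J(J(a,b),d)] with [d <> 0] codes the rational [(a - b) / d];
    a rational has many codes, and the relations and operations below are
    those of the rationals coded. *)
Definition qmk (a b d : tm) : tm := TJ (TJ a b) d.
Definition qpos (q : tm) : tm := PK ⋅ PK ⋅ q.
Definition qneg (q : tm) : tm := PL ⋅ PK ⋅ q.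
Definition qden (q : tm) : tm := PL ⋅ q.

Definition is_rat (q : tm) : form := ~ qden q == TZero.

Definition qzero : tm := qmk TZero TZero tone.
Definition qone : tm := qmk tone TZero tone.

(** [(a - b)/d < (a' - b')/d'] iff [a d' + b' d < a' d + b d'] *)
Definition qcross (q r : tm) : tm :=
  tadd (tmul (qpos q) (qden r)) (tmul (qneg r) (qden q)).
Definition qlt (q r : tm) : form := lt (qcross q r) (qcross r q).
Definition qle (q r : tm) : form := le (qcross q r) (qcross r q).

Definition qsub (q r : tm) : tm :=
  qmk (qcross q r) (qcross r q) (tmul (qden q) (qden r)).

(** [|(a - b)/d| = ((a -. b) + (b -. a)) / d], where one summand vanishes *)
Definition qabs (q : tm) : tm :=
  qmk (tadd (tsub (qpos q) (qneg q)) (tsub (qneg q) (qpos q))) TZero (qden q).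

(** [1 / 2^t] *)
Definition qtwopow_inv (t : tm) : tm := qmk tone TZero (texp ttwo t).

Definition rat_seq (f : fn) : form := AllN (is_rat (f ⋅ #0)).

Definition rat_seq_in_unit (f : fn) : form :=
  AllN (is_rat (f ⋅ #0) /\ qle qzero (f ⋅ #0) /\ qle (f ⋅ #0) qone).

(** [z] belongs to [[omega]^omega] *)
Definition incr (z : fn) : form := AllN (lt (z ⋅ #0) (z ⋅ TS #0)).

(** [|g(z(t+1)) - g(z(t))| > 1/2^t] *)
Definition jump (g z : fn) (t : tm) : form :=
  qlt (qtwopow_inv t) (qabs (qsub (g ⋅ z ⋅ TS t) (g ⋅ z ⋅ t))).

(** Here [$1] is the sequence [gamma] and [$0] is [zeta] inside the quantifier
    over [zeta]; outside it, [gamma] is [$0]. *)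
Definition Contr_BW : form :=
  AllF (rat_seq $0 =>>
        AllF (incr $0 =>> ExN (jump $1 $0 #0)) =>>
        ExN (qlt ($0 ⋅ #0) qzero \/ qlt qone ($0 ⋅ #0))).

(** Inside the quantifier over [zeta], [gamma], [alpha], [zeta] are [$2], [$1],
    [$0]. *)
Definition SC_unit : form :=
  AllF (AllF (rat_seq_in_unit $1 =>>
              AllF (incr $0 =>>
                    ExN (jump $2 $0 #0 \/ ~ $1 ⋅ #0 == TZero)) =>>
              ExN (~ $0 ⋅ #0 == TZero))).

(* Main.v *)
(** The Contr(BW) hypothesis and the SC([0,1]) hypothesis are turned into each
    other by changing the sequence.

    From SC to Contr(BW): given [gamma], let [alpha(n)] be nonzero exactly when
    [gamma(n)] lies outside [[0,1]], and clip [gamma] by replacing these values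
    by [0].  A jump of [gamma] along [zeta] is a jump of the clipped sequence
    unless one of its two endpoints [m] has [alpha(m) <> 0].

    From Contr(BW) to SC: given [gamma] and [alpha], let [delta(n)] be
    [gamma(n)] as long as [alpha(i) = 0] for all [i < n], and the integer [n]
    from then on.  If [alpha(k) <> 0] for some [k], then [delta] eventually
    jumps by at least 1 along every [zeta], so [delta] satisfies the hypothesis
    of Contr(BW); and a value of [delta] outside [[0,1]] is not a value of
    [gamma], so it reveals some [i] with [alpha(i) <> 0]. *)

From Stdlib Require Import List Setoid Morphisms.
Require Import Defs.
Import ListNotations.
Local Open Scope bim_scope.

(** * Substitution and the defined notions *)

Lemma fsubst_id (f : fn) : fsubst FVar f = f.
Proof. now destruct f. Qed.

Lemma tsubst_id (t : tm) : tsubst TVar FVar t = t.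
Proof. induction t; cbn; rewrite ?fsubst_id; congruence. Qed.

Lemma tsubst_scons_shift (u : tm) sigma tau (t : tm) :
  tsubst (scons u sigma) tau (tsubst sN FVar t) = tsubst sigma tau t.
Proof. induction t; cbn; rewrite ?fsubst_id; congruence. Qed.

Lemma tsubst_upN_shift sigma tau (t : tm) :
  tsubst (upN sigma) tau (tsubst sN FVar t) = tsubst sN FVar (tsubst sigma tau t).
Proof. induction t; cbn; rewrite ?fsubst_id; congruence. Qed.

Lemma upN_0 sigma : upN sigma 0 = TVar 0.
Proof. reflexivity. Qed.

Lemma upN_S sigma i : upN sigma (S i) = tsubst sN FVar (sigma i).
Proof. reflexivity. Qed.

Section Substitution.
Context (sigma : nat -> tm) (tau : nat -> fn).
Local Notation "t '^^'" := (tsubst sigma tau t) (at level 1).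

Lemma tsubst_TS t : tsubst sigma tau (TS t) = TS t^^.
Proof. reflexivity. Qed.
Lemma tsubst_tadd t s : (tadd t s)^^ = tadd t^^ s^^.
Proof. reflexivity. Qed.
Lemma tsubst_tmul t s : (tmul t s)^^ = tmul t^^ s^^.
Proof. reflexivity. Qed.
Lemma tsubst_texp t s : (texp t s)^^ = texp t^^ s^^.
Proof. reflexivity. Qed.
Lemma tsubst_tsub t s : (tsub t s)^^ = tsub t^^ s^^.
Proof. reflexivity. Qed.
Lemma tsubst_qmk a b d : (qmk a b d)^^ = qmk a^^ b^^ d^^.
Proof. reflexivity. Qed.
Lemma tsubst_qsub q r : (qsub q r)^^ = qsub q^^ r^^.
Proof. reflexivity. Qed.
Lemma tsubst_qabs q : (qabs q)^^ = qabs q^^.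
Proof. reflexivity. Qed.
Lemma tsubst_qtwopow_inv t : (qtwopow_inv t)^^ = qtwopow_inv t^^.
Proof. reflexivity. Qed.

Lemma subst_le t s : subst sigma tau (le t s) = le t^^ s^^.
Proof.
  unfold le, tadd; cbn [subst tsubst]; now rewrite !tsubst_upN_shift.
Qed.
Lemma subst_lt t s : subst sigma tau (lt t s) = lt t^^ s^^.
Proof. apply subst_le. Qed.
Lemma subst_qlt q r : subst sigma tau (qlt q r) = qlt q^^ r^^.
Proof. apply subst_lt. Qed.
Lemma subst_qle q r : subst sigma tau (qle q r) = qle q^^ r^^.
Proof. apply subst_le. Qed.
Lemma subst_is_rat q : subst sigma tau (is_rat q) = is_rat q^^.
Proof. reflexivity. Qed.
Lemma subst_rat_seq f : subst sigma tau (rat_seq f) = rat_seq (fsubst tau f).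
Proof. reflexivity. Qed.
Lemma subst_Not A : subst sigma tau (~ A) = (~ subst sigma tau A).
Proof. reflexivity. Qed.
Lemma subst_jump g z t :
  subst sigma tau (jump g z t) = jump (fsubst tau g) (fsubst tau z) t^^.
Proof. apply subst_qlt. Qed.
End Substitution.

Lemma subst_incr sigma tau z : subst sigma tau (incr z) = incr (fsubst tau z).
Proof. unfold incr; cbn [subst]; now rewrite subst_lt. Qed.

Lemma subst_rat_seq_in_unit sigma tau f :
  subst sigma tau (rat_seq_in_unit f) = rat_seq_in_unit (fsubst tau f).
Proof. unfold rat_seq_in_unit; cbn [subst]; now rewrite !subst_qle. Qed.

Arguments upN : simpl never.
Arguments TS : simpl never.

#[local] Hint Rewrite fsubst_id tsubst_id tsubst_scons_shift tsubst_upN_shift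
  upN_0 upN_S tsubst_TS tsubst_tadd tsubst_tmul tsubst_texp tsubst_tsub
  tsubst_qmk tsubst_qsub tsubst_qabs tsubst_qtwopow_inv subst_le subst_lt
  subst_qlt subst_qle subst_is_rat subst_rat_seq subst_Not subst_jump subst_incr
  subst_rat_seq_in_unit : bim.

(** Computation pushes a substitution through connectives and quantifiers only; at [le], [qlt],
    [jump] and the other defined notions the commutation lemmas take over, so these stay folded. *)
Ltac simp := unfold instN, instF, shiftN, shiftF;
  repeat (progress (cbn [map subst fsubst scons sN sF upF];
                    repeat (progress (cbn [tsubst]; autorewrite with bim)))).
Ltac simp_in H := unfold instN, instF, shiftN, shiftF in H;
  repeat (progress (cbn [map subst fsubst scons sN sF upF] in H;
                    repeat (progress (cbn [tsubst] in H;
                                      autorewrite with bim in H)))).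

(** * Weakening and rewriting inside BIM *)

Lemma prv_weak (G G' : list form) (A : form) :
  prv G A -> incl G G' -> prv G' A.
Proof.
  intros H; revert G'; induction H; intros G' I;
    [ apply P_ax | apply P_hyp | apply P_botE | apply P_andI
    | eapply P_andE1 | eapply P_andE2 | apply P_orI1 | apply P_orI2
    | eapply P_orE | apply P_impI | eapply P_impE | apply P_allNI
    | apply P_allNE | eapply P_exNI | eapply P_exNE | apply P_allFI
    | apply P_allFE | eapply P_exFI | eapply P_exFE | apply P_eqN_refl
    | eapply P_eqN_subst | apply P_eqF_refl | eapply P_eqF_subst ];
    eauto using incl_map, incl_cons, in_eq, incl_tl.
Qed.

Lemma prv_weak1 G A B : prv G A -> prv (B :: G) A.
Proof. intros H; apply (prv_weak _ _ _ H), incl_tl, incl_refl. Qed.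

(** Derivable equality and equivalence over a fixed context serve as setoid relations, so that
    [rewrite] replaces equals inside derivations of the object theory. *)
Definition eqv (G : list form) (t s : tm) : Prop := prv G (t == s).
Definition fiff (G : list form) (A B : form) : Prop := prv G (A <=> B).

Lemma eqN_subst G A t s : eqv G t s -> prv G (instN t A) -> prv G (instN s A).
Proof. apply P_eqN_subst. Qed.

(** Leibniz substitution is applied to an equation whose left side is shifted and hence stays fixed;
    it starts from reflexivity. Symmetry and transitivity below use the same device. *)
Lemma eqN_congr G (c : tm) t s : eqv G t s ->
  eqv G (tsubst (scons t TVar) FVar c) (tsubst (scons s TVar) FVar c).
Proof.
  intros H.
  pose proof (eqN_subst G
    (tsubst sN FVar (tsubst (scons t TVar) FVar c) == c) t s H) as P.
  simp_in P. apply P, P_eqN_refl.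
Qed.

#[local] Instance eqv_equiv G : Equivalence (eqv G).
Proof.
  split.
  - intros t; apply P_eqN_refl.
  - intros t s H.
    pose proof (eqN_subst G (#0 == tsubst sN FVar t) t s H) as P.
    simp_in P. apply P, P_eqN_refl.
  - intros t s r H H'.
    pose proof (eqN_subst G (tsubst sN FVar t == #0) s r H') as P.
    simp_in P. exact (P H).
Qed.

#[local] Instance TApp_proper G f : Proper (eqv G ==> eqv G) (TApp f).
Proof.
  intros t s H. pose proof (eqN_congr G (f ⋅ #0) t s H) as P.
  simp_in P. exact P.
Qed.

#[local] Instance TJ_proper G : Proper (eqv G ==> eqv G ==> eqv G) TJ.
Proof.
  intros t t' H s s' H'.
  pose proof (eqN_congr G (TJ #0 (tsubst sN FVar s)) t t' H) as P.
  pose proof (eqN_congr G (TJ (tsubst sN FVar t') #0) s s' H') as P'.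
  simp_in P. simp_in P'. now rewrite P.
Qed.

#[local] Instance TS_proper G : Proper (eqv G ==> eqv G) TS.
Proof. apply TApp_proper. Qed.
#[local] Instance tadd_proper G : Proper (eqv G ==> eqv G ==> eqv G) tadd.
Proof. intros t t' H s s' H'; unfold tadd; now rewrite H, H'. Qed.
#[local] Instance tmul_proper G : Proper (eqv G ==> eqv G ==> eqv G) tmul.
Proof. intros t t' H s s' H'; unfold tmul; now rewrite H, H'. Qed.
#[local] Instance tsub_proper G : Proper (eqv G ==> eqv G ==> eqv G) tsub.
Proof. intros t t' H s s' H'; unfold tsub; now rewrite H, H'. Qed.
#[local] Instance qmk_proper G :
  Proper (eqv G ==> eqv G ==> eqv G ==> eqv G) qmk.
Proof.
  intros t t' H s s' H' r r' H''; unfold qmk; now rewrite H, H', H''.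
Qed.
#[local] Instance qpos_proper G : Proper (eqv G ==> eqv G) qpos.
Proof. intros t t' H; unfold qpos; now rewrite H. Qed.
#[local] Instance qneg_proper G : Proper (eqv G ==> eqv G) qneg.
Proof. intros t t' H; unfold qneg; now rewrite H. Qed.
#[local] Instance qden_proper G : Proper (eqv G ==> eqv G) qden.
Proof. intros t t' H; unfold qden; now rewrite H. Qed.
#[local] Instance qcross_proper G : Proper (eqv G ==> eqv G ==> eqv G) qcross.
Proof. intros t t' H s s' H'; unfold qcross; now rewrite H, H'. Qed.
#[local] Instance qsub_proper G : Proper (eqv G ==> eqv G ==> eqv G) qsub.
Proof. intros t t' H s s' H'; unfold qsub; now rewrite H, H'. Qed.
#[local] Instance qabs_proper G : Proper (eqv G ==> eqv G) qabs.
Proof. intros t t' H; unfold qabs; now rewrite H. Qed.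

#[local] Instance fiff_equiv G : Equivalence (fiff G).
Proof.
  assert (I : forall G A, prv G (A =>> A))
    by (intros; apply P_impI, P_hyp; now left).
  assert (T : forall G A B C,
    prv G (A =>> B) -> prv G (B =>> C) -> prv G (A =>> C)).
  { intros G' A B C H H'. apply P_impI, (P_impE _ B), (P_impE _ A);
      [ now apply prv_weak1 | now apply prv_weak1 | apply P_hyp; now left ]. }
  split.
  - intros A; apply P_andI; apply I.
  - intros A B H; apply P_andI; [ eapply P_andE2 | eapply P_andE1 ]; exact H.
  - intros A B C H H'; apply P_andI; eapply T;
      first [ eapply P_andE1; eassumption | eapply P_andE2; eassumption ].
Qed.

#[local] Instance prv_proper G : Proper (fiff G ==> iff) (prv G).
Proof.
  intros A B H; split; intros P;
    [ apply (P_impE _ A) | apply (P_impE _ B) ]; trivial;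
    [ eapply P_andE1 | eapply P_andE2 ]; exact H.
Qed.

Lemma fiff_subst G A t s : eqv G t s -> fiff G (instN t A) (instN s A).
Proof.
  intros H.
  assert (K : forall t s, eqv G t s -> prv G (instN t A =>> instN s A)).
  { intros t' s' E. apply P_impI, (eqN_subst _ _ t').
    - now apply prv_weak1.
    - apply P_hyp; now left. }
  apply P_andI; apply K; trivial; now symmetry.
Qed.

#[local] Instance EqN_proper G : Proper (eqv G ==> eqv G ==> fiff G) EqN.
Proof.
  intros t t' H s s' H'.
  pose proof (fiff_subst G (#0 == tsubst sN FVar s) _ _ H) as P.
  pose proof (fiff_subst G (tsubst sN FVar t' == #0) _ _ H') as P'.
  simp_in P; simp_in P'. now rewrite P.
Qed.

#[local] Instance le_proper G : Proper (eqv G ==> eqv G ==> fiff G) le.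
Proof.
  intros t t' H s s' H'.
  pose proof (fiff_subst G (le #0 (tsubst sN FVar s)) _ _ H) as P.
  pose proof (fiff_subst G (le (tsubst sN FVar t') #0) _ _ H') as P'.
  simp_in P; simp_in P'. now rewrite P.
Qed.
#[local] Instance lt_proper G : Proper (eqv G ==> eqv G ==> fiff G) lt.
Proof. intros t t' H s s' H'; unfold lt; now rewrite H, H'. Qed.
#[local] Instance qlt_proper G : Proper (eqv G ==> eqv G ==> fiff G) qlt.
Proof. intros t t' H s s' H'; unfold qlt; now rewrite H, H'. Qed.
#[local] Instance qle_proper G : Proper (eqv G ==> eqv G ==> fiff G) qle.
Proof. intros t t' H s s' H'; unfold qle; now rewrite H, H'. Qed.

#[local] Instance And_proper G : Proper (fiff G ==> fiff G ==> fiff G) And.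
Proof.
  assert (K : forall A A' B B', fiff G A A' -> fiff G B B' ->
    prv G (A /\ B =>> A' /\ B')).
  { intros A A' B B' H H'. apply P_impI, P_andI.
    - apply (P_impE _ A); [ apply prv_weak1; eapply P_andE1; exact H | ].
      eapply P_andE1, P_hyp; now left.
    - apply (P_impE _ B); [ apply prv_weak1; eapply P_andE1; exact H' | ].
      eapply P_andE2, P_hyp; now left. }
  intros A A' H B B' H'; apply P_andI; apply K; trivial; now symmetry.
Qed.

#[local] Instance Not_proper G : Proper (fiff G ==> fiff G) Not.
Proof.
  assert (K : forall A B, fiff G A B -> prv G (~ A =>> ~ B)).
  { intros A B H. apply P_impI, P_impI, (P_impE _ A).
    - apply P_hyp; right; now left.
    - apply (P_impE _ B); [ | apply P_hyp; now left ].
      do 2 apply prv_weak1. eapply P_andE2; exact H. }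
  intros A B H; apply P_andI; apply K; trivial; now symmetry.
Qed.

#[local] Instance is_rat_proper G : Proper (eqv G ==> fiff G) is_rat.
Proof. intros t t' H; unfold is_rat; now rewrite H. Qed.

(** * Tactics for derivations in BIM *)

Ltac hyp := solve [ apply P_hyp; repeat (first [ left; reflexivity | right ]) ].
Ltac as_eqv E :=
  try match type of E with prv ?G (?t == ?s) => change (eqv G t s) in E end.
Tactic Notation "pull" constr(n) "as" ident(E) :=
  lazymatch goal with
  | |- ?P =>
    let G := match P with prv ?G _ => G | eqv ?G _ _ => G end in
    let A := eval cbn [nth] in (nth n G Bot) in
    assert (E : prv G A) by hyp; as_eqv E
  end.
Ltac weaken H :=
  lazymatch goal with
  | |- prv (?B :: ?G) _ => apply (prv_weak1 G _ B) in H; as_eqv H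
  | |- eqv (?B :: ?G) _ _ => apply (prv_weak1 G _ B) in H; as_eqv H
  end.
Tactic Notation "detach" hyp(E) "with" constr(H) :=
  let T := fresh in
  assert (T := P_impE _ _ _ E H); clear E; rename T into E.
Tactic Notation "recall" constr(L) "as" ident(E) :=
  lazymatch goal with
  | |- prv ?G _ => assert (E := L G)
  | |- eqv ?G _ _ => assert (E := L G)
  end.
Tactic Notation "instN" hyp(E) "with" constr(t) :=
  apply (P_allNE _ _ t) in E; simp_in E; as_eqv E.
Tactic Notation "instF" hyp(E) "with" constr(f) :=
  apply (P_allFE _ _ f) in E; simp_in E; as_eqv E.

(** * Arithmetic in BIM *)

Section Equations.
Context (G : list form).
Local Notation "t ≡ s" := (eqv G t s) (at level 70).

Lemma PId_eq t : PId ⋅ t ≡ t.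
Proof. assert (E := P_ax G _ Ax_id). now instN E with t. Qed.
Lemma PZero_eq t : PZero ⋅ t ≡ TZero.
Proof. assert (E := P_ax G _ Ax_zero). now instN E with t. Qed.
Lemma PK_eq t s : PK ⋅ TJ t s ≡ t.
Proof. assert (E := P_ax G _ Ax_K). instN E with t. now instN E with s. Qed.
Lemma PL_eq t s : PL ⋅ TJ t s ≡ s.
Proof. assert (E := P_ax G _ Ax_L). instN E with t. now instN E with s. Qed.
Lemma PComp_eq f g t : PComp f g ⋅ t ≡ f ⋅ g ⋅ t.
Proof. assert (E := P_ax G _ (Ax_comp f g)). now instN E with t. Qed.
Lemma PPair_eq f g t : PPair f g ⋅ t ≡ TJ (f ⋅ t) (g ⋅ t).
Proof. assert (E := P_ax G _ (Ax_pair f g)). now instN E with t. Qed.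
Lemma PRec_0 f g t : PRec f g ⋅ TJ t TZero ≡ f ⋅ t.
Proof. assert (E := P_ax G _ (Ax_rec0 f g)). now instN E with t. Qed.
Lemma PRec_S f g t s :
  PRec f g ⋅ TJ t (TS s) ≡ g ⋅ TJ (TJ t s) (PRec f g ⋅ TJ t s).
Proof.
  assert (E := P_ax G _ (Ax_recS f g)). instN E with t. now instN E with s.
Qed.

Lemma add_0_r t : tadd t TZero ≡ t.
Proof. unfold tadd, PAdd. now rewrite PRec_0, PId_eq. Qed.
Lemma add_S_r t s : tadd t (TS s) ≡ TS (tadd t s).
Proof. unfold tadd, PAdd at 1. now rewrite PRec_S, PComp_eq, PL_eq. Qed.
Lemma mul_0_r t : tmul t TZero ≡ TZero.
Proof. unfold tmul, PMul. now rewrite PRec_0, PZero_eq. Qed.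
Lemma mul_S_r t s : tmul t (TS s) ≡ tadd (tmul t s) t.
Proof.
  unfold tmul, PMul at 1.
  now rewrite PRec_S, PComp_eq, PPair_eq, PL_eq, PComp_eq, !PK_eq.
Qed.
Lemma exp_0_r t : texp t TZero ≡ tone.
Proof. unfold texp, PExp. now rewrite PRec_0, PComp_eq, PZero_eq. Qed.
Lemma exp_S_r t s : texp t (TS s) ≡ tmul (texp t s) t.
Proof.
  unfold texp, PExp at 1.
  now rewrite PRec_S, PComp_eq, PPair_eq, PL_eq, PComp_eq, !PK_eq.
Qed.
Lemma pred_0 : PPred ⋅ TZero ≡ TZero.
Proof.
  unfold PPred.
  now rewrite PComp_eq, PPair_eq, PZero_eq, PId_eq, PRec_0, PZero_eq.
Qed.
Lemma pred_S t : PPred ⋅ TS t ≡ t.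
Proof.
  unfold PPred.
  now rewrite PComp_eq, PPair_eq, PZero_eq, PId_eq, PRec_S, PComp_eq, PK_eq,
    PL_eq.
Qed.
Lemma sub_0_r t : tsub t TZero ≡ t.
Proof. unfold tsub, PSub. now rewrite PRec_0, PId_eq. Qed.
Lemma sub_S_r t s : tsub t (TS s) ≡ PPred ⋅ tsub t s.
Proof. unfold tsub, PSub at 1. now rewrite PRec_S, PComp_eq, PL_eq. Qed.
End Equations.

Lemma prv_ind G A t :
  prv G (instN TZero A) ->
  prv (A :: map shiftN G) (subst (scons (TS #0) sN) FVar A) ->
  prv G (instN t A).
Proof.
  intros H0 HS. apply P_allNE.
  refine (P_impE _ _ _ (P_impE _ _ _ (P_ax _ _ (Ax_ind A)) H0) _).
  now apply P_allNI, P_impI.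
Qed.

Ltac goal_eqv :=
  try match goal with |- prv ?G (?t == ?s) => change (eqv G t s) end.
(* Rewriting would otherwise also try to replace inside the context. *)
Ltac hide_ctx :=
  let Gamma := fresh "Gamma" in
  lazymatch goal with
  | |- eqv ?G _ _ => set (Gamma := G) in *; clearbody Gamma
  | |- prv ?G _ => set (Gamma := G) in *; clearbody Gamma
  end; goal_eqv.
Ltac induct_in G A t IH :=
  let K := fresh in
  assert (K := prv_ind G A t); simp_in K; apply K; clear K;
  [ | pull 0 as IH ]; goal_eqv.
Tactic Notation "induct" constr(A) "on" constr(t) "as" ident(IH) :=
  lazymatch goal with
  | |- eqv ?G _ _ => induct_in G A t IH
  | |- prv ?G _ => induct_in G A t IH
  end.

Lemma add_0_l G t : eqv G (tadd TZero t) t.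
Proof.
  induct (tadd TZero #0 == #0) on t as IH.
  - now rewrite add_0_r.
  - hide_ctx. now rewrite add_S_r, IH.
Qed.

Lemma add_S_l G t s : eqv G (tadd (TS t) s) (TS (tadd t s)).
Proof.
  induct (tadd (TS (tsubst sN FVar t)) #0 == TS (tadd (tsubst sN FVar t) #0))
    on s as IH.
  - now rewrite !add_0_r.
  - hide_ctx. now rewrite !add_S_r, IH.
Qed.

Lemma mul_0_l G t : eqv G (tmul TZero t) TZero.
Proof.
  induct (tmul TZero #0 == TZero) on t as IH.
  - now rewrite mul_0_r.
  - hide_ctx. now rewrite mul_S_r, add_0_r, IH.
Qed.

Lemma mul_1_r G t : eqv G (tmul t tone) t.
Proof. unfold tone. now rewrite mul_S_r, mul_0_r, add_0_l. Qed.

Lemma sub_SS G t s : eqv G (tsub (TS t) (TS s)) (tsub t s).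
Proof.
  induct (tsub (TS (tsubst sN FVar t)) (TS #0) == tsub (tsubst sN FVar t) #0)
    on s as IH.
  - now rewrite sub_S_r, !sub_0_r, pred_S.
  - hide_ctx. now rewrite sub_S_r, IH, sub_S_r.
Qed.

Lemma sub_add G t s : eqv G (tsub t (tadd t s)) TZero.
Proof.
  induct (tsub (tsubst sN FVar t) (tadd (tsubst sN FVar t) #0) == TZero)
    on s as IH.
  - rewrite add_0_r.
    induct (tsub #0 #0 == TZero) on t as IH.
    + now rewrite sub_0_r.
    + hide_ctx. now rewrite sub_SS.
  - hide_ctx. now rewrite add_S_r, sub_S_r, IH, pred_0.
Qed.

Lemma add_sub G t s : eqv G (tsub (tadd t s) t) s.
Proof.
  induct (tsub (tadd #0 (tsubst sN FVar s)) #0 == tsubst sN FVar s) on t as IH.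
  - now rewrite add_0_l, sub_0_r.
  - hide_ctx. now rewrite add_S_l, sub_SS.
Qed.

(* Naming the predecessor by [PPred] instead of an existential quantifier spares
   a shift of the context at every case distinction. *)
Lemma zero_or_succ G t : prv G (t == TZero \/ t == TS (PPred ⋅ t)).
Proof.
  induct (#0 == TZero \/ #0 == TS (PPred ⋅ #0)) on t as IH.
  - apply P_orI1, P_eqN_refl.
  - apply P_orI2. hide_ctx. rewrite pred_S. apply P_eqN_refl.
Qed.

Lemma S_neq_0 G t C : eqv G (TS t) TZero -> prv G C.
Proof.
  intros H. assert (E := P_ax G _ Ax_S_nonzero). instN E with t.
  apply P_botE. exact (P_impE _ _ _ E H).
Qed.

(** Intuitionistically sound because [zero_or_succ] decides equality with 0. *)
Lemma not_0_succ G t : prv G (~ t == TZero) -> eqv G t (TS (PPred ⋅ t)).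
Proof.
  intros H. apply (P_orE _ _ _ _ (zero_or_succ G t)).
  - apply P_botE, (P_impE _ (t == TZero)); [ now apply prv_weak1 | hyp ].
  - hyp.
Qed.

Lemma succ_not_0 G t s : eqv G t (TS s) -> prv G (~ t == TZero).
Proof.
  intros H. apply P_impI.
  assert (H' : eqv ((t == TZero) :: G) t (TS s)) by now apply prv_weak1.
  pull 0 as E. hide_ctx. apply (S_neq_0 _ s). now rewrite <- H'.
Qed.

Lemma le_intro G t s r : eqv G (tadd t r) s -> prv G (le t s).
Proof. intros H. apply (P_exNI _ _ r). now simp. Qed.

Lemma le_0 G t : prv G (le TZero t).
Proof. apply (le_intro _ _ _ t), add_0_l. Qed.

Lemma le_refl G t : prv G (le t t).
Proof. apply (le_intro _ _ _ TZero), add_0_r. Qed.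

(** Induction on [t]. If [t + 1 + r = s], then [r = 0] gives [s = t + 1], while for [r > 0] the
    predecessor of [r] witnesses [t + 1 < s]. *)
Lemma le_or_lt G t s : prv G (le s t \/ lt t s).
Proof.
  induct (le (tsubst sN FVar s) #0 \/ lt #0 (tsubst sN FVar s)) on t as IH.
  - apply (P_orE _ _ _ _ (zero_or_succ G s)); pull 0 as E.
    + hide_ctx. apply P_orI1. rewrite E. apply le_0.
    + hide_ctx. apply P_orI2, (le_intro _ _ _ (PPred ⋅ s)).
      now rewrite add_S_l, add_0_l, <- E.
  - apply (P_orE _ _ _ _ IH).
    + apply P_orI1. eapply P_exNE; [ hyp | ]. simp. pull 0 as E.
      hide_ctx. apply (le_intro _ _ _ (TS #0)). now rewrite add_S_r, E.
    + eapply P_exNE; [ hyp | ]. simp.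
      apply (P_orE _ _ _ _ (zero_or_succ _ #0)); pull 0 as E; pull 1 as E'.
      * hide_ctx. apply P_orI1. rewrite <- E', E, add_0_r. apply le_refl.
      * hide_ctx. apply P_orI2. apply (le_intro _ _ _ (PPred ⋅ #0)).
        now rewrite <- E', E, add_S_l, add_S_r, pred_S.
Qed.

(** This lemma and the next two translate between the order and truncated differences, which the
    functions of BIM can compute and test for zero. *)
Lemma le_of_sub G t s : eqv G (tsub s t) TZero -> prv G (le s t).
Proof.
  intros H. apply (P_orE _ _ _ _ (le_or_lt G t s)); [ hyp | ].
  (* The equation is moved into the object context so that [P_exNE] shifts it together with the
     other hypotheses. *)
  apply (P_impE _ (tsub s t == TZero)); [ apply P_impI | now apply prv_weak1 ].
  eapply (P_exNE (_ :: lt t s :: G)); [ hyp | ]. simp.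
  pull 0 as E; pull 1 as E'.
  hide_ctx. apply (S_neq_0 _ #0). rewrite <- E', <- E.
  now rewrite add_S_l, <- add_S_r, add_sub.
Qed.

Lemma lt_of_sub G t s r : eqv G (tsub s t) (TS r) -> prv G (lt t s).
Proof.
  intros H. apply (P_orE _ _ _ _ (le_or_lt G t s)); [ | hyp ].
  apply (P_impE _ (tsub s t == TS r)); [ apply P_impI | now apply prv_weak1 ].
  eapply (P_exNE (_ :: le s t :: G)); [ hyp | ]. simp.
  pull 0 as E; pull 1 as E'.
  hide_ctx. apply (S_neq_0 _ (tsubst sN FVar r)). rewrite <- E', <- E.
  now rewrite sub_add.
Qed.

Lemma sub_of_le G t s : prv G (le t s) -> eqv G (tsub t s) TZero.
Proof.
  intros H. apply (P_exNE _ _ _ H). simp. pull 0 as E. hide_ctx.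
  now rewrite <- E, sub_add.
Qed.

Lemma lt_not_le G t s C : prv G (lt t s) -> prv G (le s t) -> prv G C.
Proof.
  intros H H'. apply sub_of_le in H'. unfold lt in H.
  apply P_botE, (P_impE _ (tsub s t == TZero)); [ | exact H' ].
  apply (P_exNE _ _ _ H). simp. apply P_impI. pull 0 as E; pull 1 as E'.
  hide_ctx. apply (S_neq_0 _ #0). rewrite <- E, <- E'.
  now rewrite add_S_l, <- add_S_r, add_sub.
Qed.

Lemma add_eq_0_l G t s : eqv G (tadd t s) TZero -> eqv G t TZero.
Proof.
  intros H. assert (H' := H).
  apply (P_orE _ _ _ _ (zero_or_succ G s)); pull 0 as E;
    weaken H; hide_ctx.
  - rewrite E, add_0_r in H. apply H.
  - rewrite E, add_S_r in H. exact (S_neq_0 _ _ _ H).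
Qed.

Lemma add_eq_0_r G t s : eqv G (tadd t s) TZero -> eqv G s TZero.
Proof.
  intros H. assert (E := add_eq_0_l _ _ _ H). now rewrite E, add_0_l in H.
Qed.

Lemma add_eq_S G t s r : eqv G (tadd t s) (TS r) ->
  prv G (t == TS (PPred ⋅ t) \/ s == TS (PPred ⋅ s)).
Proof.
  intros H. apply (P_orE _ _ _ _ (zero_or_succ G s)); [ | apply P_orI2; hyp ].
  pull 0 as E. apply P_orI1. apply not_0_succ, (succ_not_0 _ _ r).
  weaken H. hide_ctx. rewrite E, add_0_r in H. apply H.
Qed.

(** Recursion serves only as a case distinction: the step discards the previous value and returns
    the second component of the parameter. *)
Definition PIf : pr := PRec PK (PComp PL (PComp PK PK)).

Lemma if_0 G a b c : eqv G c TZero -> eqv G (PIf ⋅ TJ (TJ a b) c) a.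
Proof. intros H. unfold PIf. now rewrite H, PRec_0, PK_eq. Qed.

Lemma if_S G a b c d : eqv G c (TS d) -> eqv G (PIf ⋅ TJ (TJ a b) c) b.
Proof.
  intros H. unfold PIf. now rewrite H, PRec_S, !PComp_eq, !PK_eq, PL_eq.
Qed.

(** * Rational codes *)

(** [qzero], [qone] and [qcross] build terms, whereas the closure axioms compose functions; the
    constants below are the corresponding functions. *)
Definition POne : pr := PComp PSucc PZero.
Definition PQZero : pr := PPair (PPair PZero PZero) POne.
Definition PQOne : pr := PPair (PPair POne PZero) POne.
Definition PQNat : pr := PPair (PPair PId PZero) POne.
Definition PCross (f g : pr) : pr :=
  PComp PAdd (PPair
    (PComp PMul (PPair (PComp PK (PComp PK f)) (PComp PL g)))
    (PComp PMul (PPair (PComp PL (PComp PK g)) (PComp PL f)))).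

Lemma one_eq G t : eqv G (POne ⋅ t) tone.
Proof. unfold POne. now rewrite PComp_eq, PZero_eq. Qed.
Lemma qzero_eq G t : eqv G (PQZero ⋅ t) qzero.
Proof. unfold PQZero. now rewrite !PPair_eq, PZero_eq, one_eq. Qed.
Lemma qone_eq G t : eqv G (PQOne ⋅ t) qone.
Proof. unfold PQOne. now rewrite !PPair_eq, PZero_eq, one_eq. Qed.
Lemma qnat_eq G t : eqv G (PQNat ⋅ t) (qmk t TZero tone).
Proof. unfold PQNat. now rewrite !PPair_eq, PZero_eq, PId_eq, one_eq. Qed.
Lemma cross_eq G f g t : eqv G (PCross f g ⋅ t) (qcross (f ⋅ t) (g ⋅ t)).
Proof.
  unfold PCross.
  now rewrite !PComp_eq, !PPair_eq, !PComp_eq, !PPair_eq, !PComp_eq.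
Qed.

(* The sum of the excesses of [0] over [q] and of [q] over [1], each scaled by
   the denominators: it vanishes exactly on codes of rationals in [[0,1]]. *)
Definition PExcess : pr :=
  PComp PAdd (PPair
    (PComp PSub (PPair (PCross PQZero PId) (PCross PId PQZero)))
    (PComp PSub (PPair (PCross PId PQOne) (PCross PQOne PId)))).

Definition PClip : pr := PComp PIf (PPair (PPair PId PQZero) PExcess).

Lemma excess_eq G q : eqv G (PExcess ⋅ q)
  (tadd (tsub (qcross qzero q) (qcross q qzero))
        (tsub (qcross q qone) (qcross qone q))).
Proof.
  unfold PExcess.
  now rewrite PComp_eq, PPair_eq, !PComp_eq, !PPair_eq, !cross_eq, qzero_eq,
    qone_eq, PId_eq.
Qed.

Lemma excess_0 G q : eqv G (PExcess ⋅ q) TZero ->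
  prv G (qle qzero q /\ qle q qone).
Proof.
  intros H. rewrite excess_eq in H. apply P_andI; apply le_of_sub.
  - exact (add_eq_0_l _ _ _ H).
  - exact (add_eq_0_r _ _ _ H).
Qed.

Lemma excess_S G q r : eqv G (PExcess ⋅ q) (TS r) ->
  prv G (qlt q qzero \/ qlt qone q).
Proof.
  intros H. rewrite excess_eq in H.
  apply (P_orE _ _ _ _ (add_eq_S _ _ _ _ H)); pull 0 as E;
    [ apply P_orI1 | apply P_orI2 ]; exact (lt_of_sub _ _ _ _ E).
Qed.

Lemma clip_0 G q : eqv G (PExcess ⋅ q) TZero -> eqv G (PClip ⋅ q) q.
Proof.
  intros H. unfold PClip. rewrite PComp_eq, !PPair_eq, if_0 by exact H.
  apply PId_eq.
Qed.

Lemma clip_S G q r : eqv G (PExcess ⋅ q) (TS r) -> eqv G (PClip ⋅ q) qzero.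
Proof.
  intros H. unfold PClip. rewrite PComp_eq, !PPair_eq, (if_S _ _ _ _ _ H).
  apply qzero_eq.
Qed.

Lemma qpos_qmk G a b d : eqv G (qpos (qmk a b d)) a.
Proof. unfold qpos, qmk. now rewrite !PK_eq. Qed.
Lemma qneg_qmk G a b d : eqv G (qneg (qmk a b d)) b.
Proof. unfold qneg, qmk. now rewrite PK_eq, PL_eq. Qed.
Lemma qden_qmk G a b d : eqv G (qden (qmk a b d)) d.
Proof. unfold qden, qmk. now rewrite PL_eq. Qed.

Lemma qmk_is_rat G a b : prv G (is_rat (qmk a b tone)).
Proof. apply (succ_not_0 _ _ TZero), qden_qmk. Qed.

Lemma qzero_le_qone G : prv G (qle qzero qone).
Proof.
  unfold qle, qcross, qzero, qone.
  rewrite !qpos_qmk, !qneg_qmk, !qden_qmk, mul_0_l, add_0_l.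
  apply le_0.
Qed.

Lemma mul_2_r G t : eqv G (tmul t ttwo) (tadd t t).
Proof. unfold ttwo. now rewrite mul_S_r, mul_1_r. Qed.

Lemma two_pow_succ G t : eqv G (texp ttwo t) (TS (PPred ⋅ texp ttwo t)).
Proof.
  induct (texp ttwo #0 == TS (PPred ⋅ texp ttwo #0)) on t as IH; hide_ctx.
  - rewrite exp_0_r. unfold tone. now rewrite pred_S.
  - now rewrite exp_S_r, mul_2_r, IH, add_S_r, pred_S.
Qed.

(* [1/2^(k+1) < 1 <= |b - a|]; for the exponent [0] the first inequality would
   not be strict. *)
Lemma qnat_jump G k a b : prv G (lt a b) ->
  prv G (qlt (qtwopow_inv (TS k))
             (qabs (qsub (qmk b TZero tone) (qmk a TZero tone)))).
Proof.
  intros H. apply (P_exNE _ _ _ H). simp. pull 0 as E. hide_ctx.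
  unfold qlt, qtwopow_inv, qabs, qsub, qcross.
  rewrite !qpos_qmk, !qneg_qmk, !qden_qmk, !mul_1_r, !mul_0_l, !add_0_r.
  rewrite <- E.
  rewrite add_S_l, <- add_S_r, add_sub, sub_add, add_0_r.
  (* The numerator of the absolute value is now a successor. Since [2^(k+1)] is a double successor,
     their product is at least 2 and so exceeds 1. *)
  rewrite exp_S_r, mul_2_r, two_pow_succ, add_S_r, add_S_l.
  rewrite !mul_S_r, !add_S_r, add_S_l.
  unfold lt, tone. eapply le_intro. rewrite !add_S_l, add_0_l. reflexivity.
Qed.

(** * From SC([0,1]) to Contr(BW) *)

Lemma subst_Contr_BW sigma tau : subst sigma tau Contr_BW = Contr_BW.
Proof. reflexivity. Qed.
Lemma subst_SC_unit sigma tau : subst sigma tau SC_unit = SC_unit.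
Proof. reflexivity. Qed.
#[local] Hint Rewrite subst_Contr_BW subst_SC_unit : bim.

(** Closure under composition as an elimination rule: the composite becomes the fresh variable [$0],
    its defining equation becomes the newest hypothesis, and all older function indices rise by
    one. *)
Lemma prv_comp G f g C :
  prv (AllN ($0 ⋅ #0 == fsubst sF f ⋅ fsubst sF g ⋅ #0) :: map shiftF G) (shiftF C) ->
  prv G C.
Proof.
  intros H. assert (E := P_ax G _ Ax_closed_comp).
  instF E with f. instF E with g.
  destruct f; exact (P_exFE _ _ _ E H).
Qed.

Lemma SC_unit_imp_Contr_BW : BIM_proves (SC_unit =>> Contr_BW).
Proof.
  apply P_impI. unfold Contr_BW at 1. apply P_allFI, P_impI, P_impI.
  simp.
  apply (prv_comp _ PClip $0). simp.
  apply (prv_comp _ PExcess $1). simp.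
  (* Here [$2] is gamma, [$1] its clipped version, and [$0], in the role of alpha, its excess over
     the unit interval. *)
  pull 4 as SC. instF SC with $1. instF SC with $0.
  eapply P_exNE; [ refine (P_impE _ _ _ (P_impE _ _ _ SC _) _) | ]; clear SC.
  - unfold rat_seq_in_unit. apply P_allNI. simp.
    pull 0 as Ea; instN Ea with #0. pull 1 as Ed; instN Ed with #0.
    pull 3 as R. instN R with #0.
    apply (P_orE _ _ _ _ (zero_or_succ _ (PExcess ⋅ $2 ⋅ #0))); pull 0 as E;
    weaken Ed; weaken R; hide_ctx; rewrite Ed.
    + rewrite (clip_0 _ _ E). apply P_andI; [ exact R | now apply excess_0 ].
    + rewrite (clip_S _ _ _ E). apply P_andI; [ apply qmk_is_rat | ].
      apply P_andI; [ apply le_refl | apply qzero_le_qone ].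
  - apply P_allFI, P_impI. simp.
    pull 3 as J. instF J with $0.
    refine (P_exNE _ _ _ (P_impE _ _ _ J _) _); [ hyp | ]. clear J. simp.
    (* Given a jump of gamma at [n], it is decided whether the two endpoints [zeta(n)] and
       [zeta(n+1)] have excess 0. *)
    apply (P_orE _ _ _ _ (zero_or_succ _ ($1 ⋅ $0 ⋅ #0))).
    apply (P_orE _ _ _ _ (zero_or_succ _ ($1 ⋅ $0 ⋅ TS #0))).
    + apply (P_exNI _ _ #0). simp. apply P_orI1.
      pull 0 as E1. pull 1 as E0. pull 2 as J.
      pull 4 as Ea. assert (Ea' := Ea).
      instN Ea with ($0 ⋅ #0). instN Ea' with ($0 ⋅ TS #0).
      pull 5 as Ed. assert (Ed' := Ed).
      instN Ed with ($0 ⋅ #0). instN Ed' with ($0 ⋅ TS #0).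
      hide_ctx. rewrite Ea in E0. rewrite Ea' in E1. unfold jump.
      rewrite Ed, Ed', (clip_0 _ _ E0), (clip_0 _ _ E1). exact J.
    (* The index to supply is the bad endpoint itself rather than the position of the jump, because
       alpha is evaluated at that index. *)
    + apply (P_exNI _ _ ($0 ⋅ TS #0)). simp. apply P_orI2.
      pull 0 as E. hide_ctx. exact (succ_not_0 _ _ _ E).
    + apply (P_exNI _ _ ($0 ⋅ #0)). simp. apply P_orI2.
      pull 0 as E. hide_ctx. exact (succ_not_0 _ _ _ E).
  - simp. apply (P_exNI _ _ #0). simp.
    pull 0 as N. pull 1 as Ea. instN Ea with #0. hide_ctx.
    rewrite Ea in N. exact (excess_S _ _ _ (not_0_succ _ _ N)).
Qed.

(** * From Contr(BW) to SC([0,1]) *)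

Lemma prv_comp2 G f g h C :
  prv (AllN ($0 ⋅ #0 == fsubst sF f ⋅ TJ (fsubst sF g ⋅ #0) (fsubst sF h ⋅ #0))
       :: map shiftF G) (shiftF C) ->
  prv G C.
Proof.
  intros H. assert (E := P_ax G _ Ax_closed_comp2).
  instF E with f. instF E with g. instF E with h.
  destruct f, g; exact (P_exFE _ _ _ E H).
Qed.

Lemma prv_rec G f g C :
  prv (AllN (AllN ($0 ⋅ TJ #1 TZero == fsubst sF f ⋅ #1 /\
                   $0 ⋅ TJ #1 (TS #0)
                   == fsubst sF g ⋅ TJ (TJ #1 #0) ($0 ⋅ TJ #1 #0)))
       :: map shiftF G) (shiftF C) ->
  prv G C.
Proof.
  intros H. assert (E := P_ax G _ Ax_closed_rec).
  instF E with f. instF E with g.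
  destruct f; exact (P_exFE _ _ _ E H).
Qed.

Lemma add_assoc G t s r : eqv G (tadd (tadd t s) r) (tadd t (tadd s r)).
Proof.
  induct (tadd (tadd #0 (tsubst sN FVar s)) (tsubst sN FVar r)
          == tadd #0 (tadd (tsubst sN FVar s) (tsubst sN FVar r))) on t as IH.
  - now rewrite !add_0_l.
  - hide_ctx. now rewrite !add_S_l, IH.
Qed.

Lemma le_trans G t s r : prv G (le t s) -> prv G (le s r) -> prv G (le t r).
Proof.
  intros H H'. apply (P_impE _ (le s r)); [ | exact H' ].
  apply (P_exNE _ _ _ H). simp. apply P_impI.
  eapply P_exNE; [ hyp | ]. simp. pull 0 as E; pull 2 as E'. hide_ctx.
  apply (le_intro _ _ _ (tadd #1 #0)). now rewrite <- add_assoc, E', E.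
Qed.

Lemma le_SS G t s : prv G (le t s) -> prv G (le (TS t) (TS s)).
Proof.
  intros H. apply (P_exNE _ _ _ H). simp. pull 0 as E. hide_ctx.
  apply (le_intro _ _ _ #0). now rewrite add_S_l, E.
Qed.

Lemma le_S G t : prv G (le t (TS t)).
Proof.
  apply (le_intro _ _ _ tone). unfold tone. now rewrite add_S_r, add_0_r.
Qed.

(** Like the later facts about sums and jumps, this is a closed formula, so that it can be
    instantiated in any context. *)
Lemma incr_ge G : prv G (AllF (incr $0 =>> AllN (le #0 ($0 ⋅ #0)))).
Proof.
  apply P_allFI, P_impI, P_allNI. simp.
  induct (le #0 ($0 ⋅ #0)) on #0 as IH.
  - apply le_0.
  - pull 1 as I. instN I with #0. hide_ctx.
    exact (le_trans _ _ _ _ (le_SS _ _ _ IH) I).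
Qed.

(** The sum over [i < n] turns the bounded condition that [a] vanishes below [n] into a zero test,
    as [PIf] requires. The term at [n] itself is excluded. *)
Definition partial_sums (a b : fn) : form :=
  b ⋅ TZero == TZero /\ AllN (b ⋅ TS #0 == tadd (b ⋅ #0) (a ⋅ #0)).

(* Past the first [k] with [b(k) <> 0] the values of [d] are the integers
   [n], so that [d] jumps along every increasing sequence. *)
Definition switched (g b d : fn) : form :=
  AllN (d ⋅ #0 == PIf ⋅ TJ (TJ (g ⋅ #0) (qmk #0 TZero tone)) (b ⋅ #0)).

Lemma subst_partial_sums sigma tau a b :
  subst sigma tau (partial_sums a b) = partial_sums (fsubst tau a) (fsubst tau b).
Proof. reflexivity. Qed.
Lemma subst_switched sigma tau g b d :
  subst sigma tau (switched g b d)
  = switched (fsubst tau g) (fsubst tau b) (fsubst tau d).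
Proof. reflexivity. Qed.
#[local] Hint Rewrite subst_partial_sums subst_switched : bim.

Lemma switch_exists G :
  prv G (AllF (AllF (ExF (ExF (partial_sums $2 $0 /\ switched $3 $0 $1))))).
Proof.
  do 2 apply P_allFI.
  (* The recursion step receives [((p, n), previous)]: this function extracts [alpha(n)], and the
     next one adds it to the previous value. *)
  apply (prv_comp _ $0 (PComp PL PK)). simp.
  apply (prv_comp2 _ PAdd PL $0). simp.
  apply (prv_rec _ PZero $0). simp.
  (* The parameter of the recursion is a dummy, set to 0 to obtain the unary sequence of sums. *)
  apply (prv_comp _ $0 (PPair PZero PId)). simp.
  (* With the identity as outer function this forms the pair of [gamma(n)] and the integer [n], the
     two branches for [PIf]. *)
  apply (prv_comp2 _ PId $5 PQNat). simp.
  apply (prv_comp2 _ PIf $0 $1). simp.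
  apply (P_exFI _ _ $0). simp. apply (P_exFI _ _ $2). simp.
  apply P_andI; [ apply P_andI | ].
  - pull 2 as Eb. instN Eb with TZero.
    pull 3 as Er. instN Er with TZero. instN Er with TZero.
    apply P_andE1 in Er. as_eqv Er. hide_ctx.
    now rewrite Eb, PPair_eq, PId_eq, PZero_eq, Er, PZero_eq.
  - apply P_allNI. simp.
    pull 2 as Eb. assert (Eb' := Eb). instN Eb with #0. instN Eb' with (TS #0).
    pull 3 as Er. instN Er with TZero. instN Er with #0.
    apply P_andE2 in Er. as_eqv Er.
    pull 4 as Eg. instN Eg with (TJ (TJ TZero #0) ($3 ⋅ TJ TZero #0)).
    pull 5 as Es. instN Es with (TJ (TJ TZero #0) ($3 ⋅ TJ TZero #0)).
    hide_ctx. rewrite Eb, Eb', !PPair_eq, !PId_eq, !PZero_eq, Er, Eg, Es.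
    now rewrite PComp_eq, PK_eq, !PL_eq.
  - unfold switched. apply P_allNI. simp.
    pull 0 as Ed. instN Ed with #0. pull 1 as Eu. instN Eu with #0. hide_ctx.
    now rewrite Ed, Eu, PId_eq, qnat_eq.
Qed.

(** Induction inspects the finitely many summands one by one, so a nonzero term is found without
    unbounded search. *)
Lemma sums_pos G :
  prv G (AllF (AllF (partial_sums $1 $0 =>>
    AllN ($0 ⋅ #0 == TZero \/ ExN (~ $1 ⋅ #0 == TZero))))).
Proof.
  do 2 apply P_allFI. apply P_impI, P_allNI. simp.
  induct ($0 ⋅ #0 == TZero \/ ExN (~ $1 ⋅ #0 == TZero)) on #0 as IH.
  - apply P_orI1. eapply P_andE1; hyp.
  - apply (P_orE _ _ _ _ IH); [ | apply P_orI2; hyp ].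
    apply (P_orE _ _ _ _ (zero_or_succ _ ($1 ⋅ #0))); pull 0 as E.
    + apply P_orI1. pull 1 as E'.
      pull 3 as B. apply P_andE2 in B. instN B with #0. hide_ctx.
      now rewrite B, E, E', add_0_r.
    + apply P_orI2, (P_exNI _ _ #0). simp. hide_ctx. exact (succ_not_0 _ _ _ E).
Qed.

Lemma sums_mono G :
  prv G (AllF (AllF (partial_sums $1 $0 =>>
    AllN (AllN (le #1 #0 =>> ~ $0 ⋅ #1 == TZero =>> ~ $0 ⋅ #0 == TZero))))).
Proof.
  do 2 apply P_allFI. apply P_impI, P_allNI, P_allNI, P_impI. simp.
  eapply P_exNE; [ hyp | ]. simp. apply P_impI. pull 1 as E.
  (* The larger index is written as the smaller one plus their difference, and the induction runs on
     that difference. *)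
  apply (P_impE _ (~ $0 ⋅ tadd #2 #0 == TZero));
    [ apply P_impI; pull 0 as N; weaken E; hide_ctx; now rewrite <- E | ].
  induct (~ $0 ⋅ tadd #3 #0 == TZero) on #0 as IH.
  - pull 0 as N. hide_ctx. now rewrite add_0_r.
  - pull 4 as B. apply P_andE2 in B. instN B with (tadd #3 #0). hide_ctx.
    apply (succ_not_0 _ _ (tadd (PPred ⋅ $0 ⋅ tadd #3 #0) ($1 ⋅ tadd #3 #0))).
    now rewrite add_S_r, B, <- add_S_l, <- (not_0_succ _ _ IH).
Qed.

(** Both [zeta(n+1)] and [zeta(n+2)] are at least [n], so the sums are nonzero there and the
    switched sequence takes two distinct integers as values. *)
Lemma switched_jump G :
  prv G (AllF (AllF (AllF (AllF (AllF (
    partial_sums $3 $1 =>> switched $4 $1 $2 =>> incr $0 =>>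
    AllN (~ $1 ⋅ #0 == TZero =>> ExN (jump $2 $0 #0)))))))).
Proof.
  do 5 apply P_allFI. do 3 apply P_impI. apply P_allNI, P_impI. simp.
  (* The position is [n + 1], because [qnat_jump] needs a positive exponent. *)
  apply (P_exNI _ _ (TS #0)). simp.
  pull 0 as N. pull 1 as I. pull 2 as D. pull 3 as B.
  recall incr_ge as Z. instF Z with $0. detach Z with I.
  assert (Z' := Z). instN Z with (TS #0). instN Z' with (TS (TS #0)).
  recall sums_mono as M. instF M with $3. instF M with $1.
  detach M with B. instN M with #0. assert (M' := M).
  instN M with ($0 ⋅ TS #0). instN M' with ($0 ⋅ TS (TS #0)).
  assert (D' := D). instN D with ($0 ⋅ TS #0). instN D' with ($0 ⋅ TS (TS #0)).
  instN I with (TS #0).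
  hide_ctx. unfold jump.
  assert (L := le_trans _ _ _ _ (le_S _ #0) Z).
  assert (L' := le_trans _ _ _ _ (le_trans _ _ _ _ (le_S _ #0) (le_S _ _)) Z').
  assert (P := not_0_succ _ _ (P_impE _ _ _ (P_impE _ _ _ M L) N)).
  assert (P' := not_0_succ _ _ (P_impE _ _ _ (P_impE _ _ _ M' L') N)).
  rewrite D, D', (if_S _ _ _ _ _ P), (if_S _ _ _ _ _ P').
  now apply qnat_jump.
Qed.

Lemma prv_cut G A C : prv G A -> prv (A :: G) C -> prv G C.
Proof. intros H H'. exact (P_impE _ _ _ (P_impI _ _ _ H') H). Qed.

Lemma Contr_BW_imp_SC_unit : BIM_proves (Contr_BW =>> SC_unit).
Proof.
  apply P_impI. unfold SC_unit. do 2 apply P_allFI. do 2 apply P_impI. simp.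
  recall switch_exists as E. instF E with $1. instF E with $0.
  apply (P_exFE _ _ _ E). clear E. simp. eapply P_exFE; [ hyp | ]. simp.
  pull 0 as B. assert (D := P_andE2 _ _ _ B). apply P_andE1 in B.
  recall sums_pos as P. instF P with $2. instF P with $0. detach P with B.
  (* These facts enter the object context so that later quantifier rules shift them as well. *)
  apply (prv_cut _ _ _ B). weaken D. weaken P.
  apply (prv_cut _ _ _ D). weaken P. apply (prv_cut _ _ _ P). clear.
  (* Now [$0] is the sequence of sums, [$1] is delta, [$2] alpha and [$3] gamma. *)
  pull 7 as C. instF C with $1.
  eapply P_exNE; [ refine (P_impE _ _ _ (P_impE _ _ _ C _) _) | ]; clear C.
  - unfold rat_seq. apply P_allNI. simp.
    pull 1 as D. instN D with #0. pull 6 as R. instN R with #0.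
    apply P_andE1 in R.
    apply (P_orE _ _ _ _ (zero_or_succ _ ($0 ⋅ #0))); pull 0 as E;
      weaken D; weaken R; hide_ctx; rewrite D.
    + rewrite (if_0 _ _ _ _ E). exact R.
    + rewrite (if_S _ _ _ _ _ E). apply qmk_is_rat.
  - apply P_allFI, P_impI. simp.
    pull 0 as I. pull 2 as D. pull 3 as B.
    recall switched_jump as W.
    instF W with $4. instF W with $3. instF W with $2. instF W with $1.
    instF W with $0. detach W with B. detach W with D. detach W with I.
    apply (prv_cut _ _ _ W). clear.
    pull 7 as J. instF J with $0.
    refine (P_exNE _ _ _ (P_impE _ _ _ J _) _); [ hyp | ]. clear J. simp.
    eapply P_orE; [ hyp | | ].
    (* A jump of gamma carries over to delta if the sums vanish at both endpoints; otherwise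
       [switched_jump] supplies a jump elsewhere. *)
    + apply (P_orE _ _ _ _ (zero_or_succ _ ($1 ⋅ $0 ⋅ TS #0)));
        [ apply (P_orE _ _ _ _ (zero_or_succ _ ($1 ⋅ $0 ⋅ #0))) | ].
      * apply (P_exNI _ _ #0). simp.
        pull 0 as E0. pull 1 as E1. pull 2 as J.
        pull 7 as D. assert (D' := D).
        instN D with ($0 ⋅ #0). instN D' with ($0 ⋅ TS #0).
        hide_ctx. unfold jump.
        rewrite D, D', (if_0 _ _ _ _ E0), (if_0 _ _ _ _ E1). exact J.
      * pull 0 as E. pull 4 as W. instN W with ($0 ⋅ #0).
        exact (P_impE _ _ _ W (succ_not_0 _ _ _ E)).
      * pull 0 as E. pull 3 as W. instN W with ($0 ⋅ TS #0).
        exact (P_impE _ _ _ W (succ_not_0 _ _ _ E)).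
    (* The value [alpha(n)] first enters the sum at index [n + 1]. *)
    + pull 0 as N. pull 2 as W. instN W with (TS #0).
      refine (P_impE _ _ _ W _). clear W.
      pull 6 as B. apply P_andE2 in B. instN B with #0. hide_ctx.
      apply not_0_succ in N.
      apply (succ_not_0 _ _ (tadd ($1 ⋅ #0) (PPred ⋅ $3 ⋅ #0))).
      now rewrite B, <- add_S_r, <- N.
  - simp. pull 1 as P. instN P with #0.
    (* If the sum at [n] vanishes, then [delta(n) = gamma(n)] lies in the unit interval, a
       contradiction; the other alternative is already the goal. *)
    eapply P_orE; [ exact P | | hyp ]. clear P.
    pull 0 as E. pull 1 as Q. pull 3 as D. instN D with #0.
    pull 8 as U. instN U with #0. apply P_andE2 in U.
    hide_ctx. rewrite (if_0 _ _ _ _ E) in D.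
    apply (P_orE _ _ _ _ Q); pull 0 as L; weaken D; weaken U; hide_ctx;
      rewrite D in L; apply (lt_not_le _ _ _ _ L);
        [ eapply P_andE1 | eapply P_andE2 ]; exact U.
Qed.

Theorem theorem9p1 : BIM_proves (Iff Contr_BW SC_unit).
Proof.
  apply P_andI; [ exact Contr_BW_imp_SC_unit | exact SC_unit_imp_Contr_BW ].
Qed.
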